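(* Fix a positive integer $l$. For every $n\ge 1$ let $\pi_n$ be a random permutation in $S_n$ with law $\mathbb{P}_n$. Assume that the sequence is equi-continuous in both co-ordinates, i.e. \[ \lim_{\delta\to0}\lim_{n\to\infty}\sup_{\mathbf p,\mathbf q,\mathbf r,\mathbf s\in\mathcal S(n,l):\ \|\mathbf p-\mathbf r\|_\infty\le n\delta,\ \|\mathbf q-\mathbf s\|_\infty\le n\delta}\left|\frac{\mathbb P_n(\pi_n(\mathbf p)=\mathbf q)}{\mathbb P_n(\pi_n(\mathbf r)=\mathbf s)}-1\right|=0, \] and that $\{\pi_n\}_{n\ge1}$ converges in probability to $\mu_\rho$ for some $\rho\in\mathcal C$. Then \[ \lim_{n\to\infty}\sup_{\mathbf p,\mathbf q\in\mathcal S(n,l)}\left|\frac{n^l\,\mathbb P_n(\pi_n(\mathbf p)=\mathbf q)}{\prod_{a=1}^l\rho\left(\frac{p_a}{n},\frac{q_a}{n}\right)}-1\right|=0. \]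
   Context: $[n]=\{1,\dots,n\}$. $\mathcal S(n,l)=\{\mathbf p=(p_1,\dots,p_l)\in[n]^l: p_a\ne p_b \text{ for } a\ne b\}$, with $\|\mathbf p-\mathbf q\|_\infty=\max_a|p_a-q_a|$; for a permutation $\pi_n$, $\pi_n(\mathbf p)=(\pi_n(p_1),\dots,\pi_n(p_l))$. For $\pi_n\in S_n$ let $\nu_{\pi_n}=\frac1n\sum_{i=1}^n\delta_{(i/n,\pi_n(i)/n)}$, a probability measure on $[0,1]^2$. A sequence of random permutations $\pi_n$ converges in probability to a deterministic probability measure $\mu$ on $[0,1]^2$ if for every continuous $f$ on $[0,1]^2$, $\frac1n\sum_{i=1}^n f(i/n,\pi_n(i)/n)\to\int f\,d\mu$ in probability. $\mathcal C$ is the set of strictly positive continuous functions $\rho$ on $[0,1]^2$ with $\int_0^1\rho(x,y)\,dx=\int_0^1\rho(x,y)\,dy=1$ for all $x,y$, and $\mu_\rho$ is the probability measure with density $\rho$. *)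

(* Defs.v *)
From HB Require Import structures.
From mathcomp Require Import all_boot all_order all_algebra all_fingroup.
From mathcomp Require Import all_classical all_reals all_analysis.
Set Implicit Arguments. Unset Strict Implicit. Unset Printing Implicit Defensive.
Import Order.TTheory GRing.Theory Num.Theory.
Import numFieldNormedType.Exports.
Local Open Scope classical_set_scope.
Local Open Scope ring_scope.

Section Defs.
Variable R : realType.

Definition is_law (n : nat) (P : {ffun 'S_n -> R}) : Prop :=
  (forall s, 0 <= P s) /\ \sum_(s : 'S_n) P s = 1.

Definition prob (n : nat) (P : {ffun 'S_n -> R}) (A : pred 'S_n) : R :=
  \sum_(s : 'S_n | A s) P s.

(* The ordinal i : 'I_n represents the element i+1 of [n] = {1,...,n};
   grid point (i+1)/n. *)
Definition gpt (n : nat) (i : 'I_n) : R := (i.+1)%:R / n%:R.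

Definition hit (n l : nat) (P : {ffun 'S_n -> R}) (p q : 'I_l -> 'I_n) : R :=
  prob P (fun s => [forall a, s (p a) == q a]).

Definition distinct_tuple (n l : nat) (p : 'I_l -> 'I_n) : Prop := injective p.

Definition int_sq (g : R * R -> R) : R :=
  Rintegral lebesgue_measure `[0, 1]
    (fun x => Rintegral lebesgue_measure `[0, 1] (fun y => g (x, y))).

Definition classC (rho : R * R -> R) : Prop :=
  {within `[0, 1] `*` `[0, 1], continuous rho} /\
  (forall x y, 0 <= x <= 1 -> 0 <= y <= 1 -> 0 < rho (x, y)) /\
  (forall y, 0 <= y <= 1 ->
     Rintegral lebesgue_measure `[0, 1] (fun x => rho (x, y)) = 1) /\
  (forall x, 0 <= x <= 1 ->
     Rintegral lebesgue_measure `[0, 1] (fun y => rho (x, y)) = 1).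

Definition conv_in_prob (P : forall n, {ffun 'S_n -> R}) (rho : R * R -> R) : Prop :=
  forall f : R * R -> R, {within `[0, 1] `*` `[0, 1], continuous f} ->
  forall eps : R, 0 < eps ->
  forall eta : R, 0 < eta -> exists N : nat, forall n : nat, (N <= n)%N ->
    prob (P n) (fun s =>
      eps < `| n%:R^-1 * \sum_(i < n) f (gpt i, gpt (s i))
               - int_sq (fun z => f z * rho z) |) <= eta.

Definition equicont (l : nat) (P : forall n, {ffun 'S_n -> R}) : Prop :=
  forall eps : R, 0 < eps -> exists2 delta : R, 0 < delta &
  exists N : nat, forall n : nat, (N <= n)%N ->
  forall p q r s : 'I_l -> 'I_n,
    distinct_tuple p -> distinct_tuple q -> distinct_tuple r -> distinct_tuple s ->
    (forall a, `| (p a)%:R - (r a)%:R | <= n%:R * delta :> R) ->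
    (forall a, `| (q a)%:R - (s a)%:R | <= n%:R * delta :> R) ->
    `| hit (P n) p q / hit (P n) r s - 1 | <= eps.

End Defs.

(* Main.v *)
(* Fix a tuple p, q and small tent functions u_a, v_a bumped near p_a/n, q_a/n.
   Let X_a be the integral of u_a (x) v_a against the empirical measure of the
   permutation.  Expanding E[prod_a X_a] over tuples r, s and discarding the
   O(1/n) fraction of tuples with repetitions, equicontinuity replaces every
   P(pi(r) = s) that occurs by P(pi(p) = q), so that
     E[prod_a X_a] ~ n^l P(pi(p) = q) prod_a (int u_a)(int v_a).
   On the other hand, X_a converges in probability to the integral of
   u_a (x) v_a against rho, which is close to rho(p_a/n, q_a/n)(int u_a)(int v_a)
   by uniform continuity of rho.  Comparing the two gives the claim; uniformity
   in p, q holds because the tents can be taken centred on a fixed finite grid. *)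
Require Import Defs.
From HB Require Import structures.
From mathcomp Require Import all_boot all_order all_algebra all_fingroup.
From mathcomp Require Import all_classical all_reals all_analysis.
From mathcomp Require Import ring lra zify.
Set Implicit Arguments. Unset Strict Implicit. Unset Printing Implicit Defensive.
Import Order.TTheory GRing.Theory Num.Theory.
Import numFieldNormedType.Exports.
Local Open Scope ring_scope.

(** * Continuous functions on the unit square and their iterated integrals *)

Section UnitSquare.
Local Open Scope classical_set_scope.
Variable R : realType.
Implicit Types (G : R * R -> R) (u v : R -> R).

Notation I01 := (`[0%R, 1%R] : set R).
Notation sq := (`[0%R, 1%R] `*` `[0%R, 1%R] : set (R * R)).

(** Heine's theorem, from the near-covering form of compactness. The two coordinates are kept apart
    because the tents localise them separately. *)
Lemma unif_continuous_square G : {within sq, continuous G} ->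
  forall e : R, 0 < e -> exists2 d : R, 0 < d & forall x y x' y',
    sq (x, y) -> sq (x', y') -> `|x - x'| < d -> `|y - y'| < d ->
    `|G (x, y) - G (x', y')| < e.
Proof.
move=> /subspace_continuousP cG e e0.
have cK : compact sq by apply: compact_setX; exact: segment_compact.
pose Q (d : R) (z : R * R) := sq z -> forall w, sq w ->
  `|z.1 - w.1| < d -> `|z.2 - w.2| < d -> `|G z - G w| < e.
have : \forall d \near 0^'+, sq `<=` Q d.
  apply: (compact_near_coveringP sq).1 => // z Kz.
  have e20 : 0 < e / 2 by rewrite divr_gt0.
  have := cG z Kz; move/cvgrPdist_lt => /(_ _ e20).
  rewrite near_withinE => /nbhs_ballP[r /= r0 rG].
  (* Halving the radius puts both [x] and any [w] that is [d]-close to [x] inside the ball of radius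
     [r] around [z], where [G] differs from [G z] by less than [e / 2]. *)
  exists (ball z (r / 2), [set d : R | d < r / 2]) => /=.
    split; first by apply: nbhsx_ballx; rewrite divr_gt0.
    by apply: nbhs_right_lt; rewrite divr_gt0.
  move=> [x d] /= [zx dr] Kx w Kw xw1 xw2.
  have zrx : ball z r x by apply: le_ball zx; rewrite ler_pdivrMr// ler_pMr// ler1n.
  have zrw : ball z r w.
    case: zx => /= zx1 zx2; rewrite /ball/= in zx1 zx2.
    split; rewrite /ball/=.
      rewrite -(subrKA x.1) (le_lt_trans (ler_normD _ _))// (splitr r) ltrD//.
      exact: lt_trans dr.
    rewrite -(subrKA x.2) (le_lt_trans (ler_normD _ _))// (splitr r) ltrD//.
    exact: lt_trans dr.
  rewrite -(subrKA (G z)) (le_lt_trans (ler_normD _ _))// (splitr e) ltrD//.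
    by rewrite distrC; exact: rG.
  exact: rG.
move=> /(filterI (nbhs_right_gt 0)) /filter_ex[d [/= d0 Qd]].
by exists d => // x y x' y' K1 K2 d1 d2; apply: (Qd (x, y)).
Qed.

Lemma square_min G : {within sq, continuous G} ->
  (forall z, sq z -> 0 < G z) -> exists2 c : R, 0 < c & forall z, sq z -> c <= G z.
Proof.
move=> cG G0.
have cK : compact sq by apply: compact_setX; exact: segment_compact.
have K0 : sq !=set0 by exists (0, 0); split; rewrite /= in_itv/= lexx ler01.
have [z zK minz] := compact_EVT_min K0 cK cG.
exists (G z); first by apply: G0; rewrite inE in zK.
by move=> w Kw; apply: minz; rewrite inE.
Qed.

Lemma integrable01 u : {within I01, continuous u} ->
  lebesgue_measure.-integrable I01 (EFin \o u).
Proof. by apply: continuous_compact_integrable; exact: segment_compact. Qed.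

Lemma continuous_section G (x : R) : I01 x -> {within sq, continuous G} ->
  {within I01, continuous (fun y => G (x, y))}.
Proof.
move=> Ix cG; apply/subspace_continuousP => y Iy.
apply/cvgrPdist_lt => e e0.
have [d d0 dG] := unif_continuous_square cG e0.
rewrite near_withinE; apply/nbhs_ballP; exists d => //= y' yy' Iy'.
by apply: dG => //; rewrite subrr normr0.
Qed.

(** Uniform continuity bounds the integrand's variation by [e] for all [y] at once, and the interval
    has length 1. This makes the outer integral of [int_sq] integrable, which monotonicity
    requires. *)
Lemma continuous_partial_int G : {within sq, continuous G} ->
  {within I01, continuous
    (fun x => Rintegral lebesgue_measure I01 (fun y => G (x, y)))}.
Proof.
move=> cG; apply/subspace_continuousP => x Ix.
apply/cvgrPdist_le => e e0.
have [d d0 dG] := unif_continuous_square cG e0.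
rewrite near_withinE; apply/nbhs_ballP; exists d => //= x' xx' Ix'.
have mI : measurable I01 by exact: measurable_itv.
have i1 := integrable01 (continuous_section Ix cG).
have i2 := integrable01 (continuous_section Ix' cG).
rewrite -RintegralB//.
have i3 : lebesgue_measure.-integrable I01 (EFin \o (fun y => G (x, y) - G (x', y))).
  have := @integrableB _ _ _ lebesgue_measure I01 (measurable_itv _) _ _ i1 i2.
  by apply: eq_integrable => // y _ /=; rewrite EFinB.
apply: le_trans (@le_normr_Rintegral _ _ _ lebesgue_measure I01 _ (measurable_itv _) i3) _.
have -> : e = Rintegral lebesgue_measure I01 (fun=> e).
  by rewrite Rintegral_cst//= lebesgue_measure_itv/= lte_fin ltr01 oppr0 adde0 mulr1.
apply: le_Rintegral => //.
- exact: (@integrable_norm _ _ _ lebesgue_measure _ _ i3).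
- by apply: integrable01; apply: continuous_subspaceT => ?; exact: cst_continuous.
- by move=> y Iy; apply/ltW/dG => //; rewrite subrr normr0.
Qed.

Lemma le_int_sq G1 G2 : {within sq, continuous G1} -> {within sq, continuous G2} ->
  (forall z, sq z -> G1 z <= G2 z) -> int_sq G1 <= int_sq G2.
Proof.
move=> c1 c2 le12; have mI : measurable I01 by exact: measurable_itv.
apply: le_Rintegral => //; try by apply/integrable01/continuous_partial_int.
move=> x Ix; apply: le_Rintegral => //; try exact/integrable01/continuous_section.
by move=> y Iy; apply: le12.
Qed.

End UnitSquare.

(** * Tensor test functions and tents on a grid *)

Section TestFunctions.
Local Open Scope classical_set_scope.
Variable R : realType.
Implicit Types (G rho : R * R -> R) (u v : R -> R).

Notation I01 := (`[0%R, 1%R] : set R).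
Notation sq := (`[0%R, 1%R] `*` `[0%R, 1%R] : set (R * R)).

Definition int01 u : R := Rintegral lebesgue_measure I01 u.

Lemma continuous_within_sqM G1 G2 : {within sq, continuous G1} ->
  {within sq, continuous G2} -> {within sq, continuous (fun z => G1 z * G2 z)}.
Proof. by move=> c1 c2 z; apply: continuousM; [exact: c1|exact: c2]. Qed.

Lemma continuous_fst_sq u : continuous u -> {within sq, continuous (fun z => u z.1)}.
Proof.
move=> cu; apply: continuous_subspaceT => z.
by apply: (@continuous_comp _ _ _ fst u); [exact: cvg_fst|exact: cu].
Qed.

Lemma continuous_snd_sq u : continuous u -> {within sq, continuous (fun z => u z.2)}.
Proof.
move=> cu; apply: continuous_subspaceT => z.
by apply: (@continuous_comp _ _ _ snd u); [exact: cvg_snd|exact: cu].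
Qed.

Lemma continuous_tensor_sq u v : continuous u -> continuous v ->
  {within sq, continuous (fun z => u z.1 * v z.2)}.
Proof.
move=> cu cv; apply: continuous_within_sqM.
  exact: continuous_fst_sq.
exact: continuous_snd_sq.
Qed.

Lemma int_sq_tensor u v (c : R) : continuous u -> continuous v ->
  int_sq (fun z => c * (u z.1 * v z.2)) = c * (int01 u * int01 v).
Proof.
move=> cu cv; rewrite /int_sq /int01.
have iu := integrable01 (continuous_subspaceT (A := I01) cu).
have iv := integrable01 (continuous_subspaceT (A := I01) cv).
under eq_Rintegral => x _.
  under eq_Rintegral => y _ do rewrite /= mulrA.
  rewrite (@RintegralZl _ _ _ lebesgue_measure I01 _ _ (measurable_itv _) iv) -mulrA mulrC -mulrA.
  over.
rewrite (@RintegralZr _ _ _ lebesgue_measure I01 _ _ (measurable_itv _) iu) [X in _ * X]mulrC.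
by rewrite mulrCA.
Qed.

(** The inner integral of [rho] in [y] is 1. This identifies the limit of one-coordinate
    averages. *)
Lemma int_sq_marginal rho u : classC rho -> continuous u ->
  int_sq (fun z => u z.1 * rho z) = int01 u.
Proof.
move=> [crho [_ [_ rho1]]] cu; rewrite /int_sq /int01.
apply: eq_Rintegral => x; rewrite inE => Ix.
have ir := integrable01 (continuous_section Ix crho).
rewrite /= (@RintegralZl _ _ _ lebesgue_measure I01 _ _ (measurable_itv _) ir).
by rewrite rho1 ?mulr1//; move: Ix; rewrite /= in_itv.
Qed.

(** Where [u] or [v] vanishes both sides of the pointwise comparison are 0, so [rho] has to be
    controlled only on the small rectangle carrying the tensor. *)
Lemma int_sq_tensor_bounds rho u v (c1 c2 : R) :
  {within sq, continuous rho} -> continuous u -> continuous v ->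
  (forall x, 0 <= u x) -> (forall x, 0 <= v x) ->
  (forall z, sq z -> u z.1 != 0 -> v z.2 != 0 -> c1 <= rho z <= c2) ->
  c1 * (int01 u * int01 v) <= int_sq (fun z => u z.1 * v z.2 * rho z)
                           <= c2 * (int01 u * int01 v).
Proof.
move=> crho cu cv u0 v0 rho12.
have cuv := continuous_tensor_sq cu cv.
have cuvr := continuous_within_sqM cuv crho.
have cc (c : R) : {within sq, continuous (fun z => c * (u z.1 * v z.2))}.
  apply: (@continuous_within_sqM (fun=> c)) => //.
  by apply: continuous_subspaceT => ?; exact: cst_continuous.
have key z : sq z -> c1 * (u z.1 * v z.2) <= u z.1 * v z.2 * rho z
                     <= c2 * (u z.1 * v z.2).
  move=> Kz; have [->|uz] := eqVneq (u z.1) 0; first by rewrite !(mul0r, mulr0) lexx.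
  have [->|vz] := eqVneq (v z.2) 0; first by rewrite !(mul0r, mulr0) lexx.
  have /andP[r1 r2] := rho12 z Kz uz vz.
  by rewrite ![_ * (u z.1 * v z.2)]mulrC !ler_wpM2l// mulr_ge0.
by rewrite -!int_sq_tensor//; apply/andP; split; apply: le_int_sq => // z /key/andP[].
Qed.

(** A peak of height 1 at [k/m] with slopes of size [m], hence zero outside the open interval of
    radius [1/m]. *)
Definition tent (m k : nat) (x : R) : R :=
  Num.max 0 (1 - m%:R * `|x - k%:R / m%:R|).

Lemma tent_ge0 m k x : 0 <= tent m k x.
Proof. by rewrite /tent le_max lexx. Qed.

Lemma tent_le1 m k x : tent m k x <= 1.
Proof. by rewrite /tent ge_max ler01 gerBl mulr_ge0. Qed.

Lemma tent_supp m k x : (0 < m)%N -> tent m k x != 0 -> `|x - k%:R / m%:R| < m%:R^-1.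
Proof.
move=> m0; apply: contraR; rewrite -leNgt => h; rewrite /tent; apply/eqP/max_idPl.
by rewrite subr_le0 mulrC -ler_pdivrMr ?ltr0n// div1r.
Qed.

Lemma continuous_tent m k : continuous (tent m k).
Proof.
move=> x.
have c1 : {for x, continuous (fun=> 0 : R^o)} by exact: cst_continuous.
have c2 : {for x, continuous (fun y : R => 1 - m%:R * `|y - k%:R / m%:R| : R^o)}.
  apply: continuousB; first exact: cst_continuous.
  apply: continuousM; first exact: cst_continuous.
  by apply: cvg_norm; apply: cvgB; [exact: cvg_id|exact: cvg_cst].
exact: (continuous_max c1 c2).
Qed.

(** At least one side of the peak lies in the unit interval even for [k = 0] or [k = m]; there the
    tent is at least [1/2] on a length [1/(2m)]. The bound does not depend on [k]. *)
Lemma int01_tent m k : (0 < m)%N -> (k <= m)%N -> (4 * m%:R)^-1 <= int01 (tent m k).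
Proof.
move=> m0 km; pose b : R := (2 * m%:R)^-1.
have mR : 0 < m%:R :> R by rewrite ltr0n.
have b0 : 0 < b by rewrite invr_gt0 mulr_gt0.
(* The interval of length [b] is taken to the right of the peak if [k < m], and to its left if
   [k = m]. *)
have [a a0 [ab near_c]] : exists2 a : R, 0 <= a & a + b <= 1 /\
    forall x, a <= x <= a + b -> `|x - k%:R / m%:R| <= b.
  have [kltm|mlek] := ltnP k m.
    exists (k%:R / m%:R); first by rewrite divr_ge0.
    split; last by move=> x; rewrite ler_norml; lra.
    have : k%:R + 1 <= m%:R :> R by rewrite natr1 ler_nat.
    move=> h; have -> : k%:R / m%:R + b = (k%:R + 2^-1) / m%:R.
      by rewrite /b; field; rewrite gt_eqF.
    by rewrite ler_pdivrMr// mul1r; lra.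
  have -> : k = m by apply/eqP; rewrite eqn_leq km.
  exists (1 - b).
    rewrite subr_ge0 invf_le1 ?mulr_gt0//.
    have : 1 <= m%:R :> R by rewrite ler1n.
    by lra.
  by split => [|x]; rewrite ?subrK// divff ?gt_eqF// ler_norml; lra.
pose J := (`[a, a + b] : set R).
have JI : J `<=` I01.
  by move=> x; rewrite /J/= !in_itv/=; lra.
have iT := integrable01 (continuous_subspaceT (A := I01) (@continuous_tent m k)).
have -> : (4 * m%:R)^-1 = Rintegral lebesgue_measure J (fun=> 2^-1).
  rewrite /J Rintegral_cst//= lebesgue_measure_itv/= lte_fin ltrDl b0 -EFinB/=.
  by rewrite /b; field; rewrite gt_eqF.
have iJ : lebesgue_measure.-integrable J (EFin \o tent m k).
  exact: (@integrableS _ _ _ lebesgue_measure _ _ _ (measurable_itv _) (measurable_itv _) JI iT).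
apply: (@le_trans _ _ (Rintegral lebesgue_measure J (tent m k))).
  apply: (@le_Rintegral _ _ _ lebesgue_measure J _ _ (measurable_itv _)) => //.
    apply: continuous_compact_integrable; first exact: segment_compact.
    by apply: continuous_subspaceT => ?; exact: cst_continuous.
  move=> x; rewrite /J/= in_itv/= => /near_c h; rewrite /tent le_max; apply/orP; right.
  have : m%:R * `|x - k%:R / m%:R| <= m%:R * b by rewrite ler_wpM2l.
  have -> : m%:R * b = 2^-1 by rewrite /b; field; rewrite gt_eqF.
  by lra.
rewrite /int01 /Rintegral fine_le//.
- by apply: integrable_fin_num => //; exact: measurable_itv.
- by apply: integrable_fin_num.
- apply: (@ge0_subset_integral _ _ _ lebesgue_measure J I01 (measurable_itv _) (measurable_itv _)) => //.
    by case/integrableP : iT.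
  by move=> x _; rewrite lee_fin tent_ge0.
Qed.

(** Rounding [m x] down gives [k]; the value [k = m] occurs at [x = 1], whence [m.+1] grid
    points. *)
Lemma grid_near (m : nat) (x : R) : (0 < m)%N -> 0 <= x <= 1 ->
  exists k : 'I_m.+1, `|x - k%:R / m%:R| <= m%:R^-1.
Proof.
move=> m0 /andP[x0 x1]; have mR : 0 < m%:R :> R by rewrite ltr0n.
have mx0 : 0 <= m%:R * x by rewrite mulr_ge0.
have /andP[t1 t2] := truncn_itv mx0.
have tm : (Num.truncn (m%:R * x)%R < m.+1)%N.
  by rewrite ltnS -(@ler_nat R) (le_trans t1)// ler_piMr.
exists (Ordinal tm) => /=; rewrite -(ler_pM2l mR) mulfV ?gt_eqF//.
rewrite -[X in X * `|_|]gtr0_norm// -normrM mulrBr mulrCA mulfV ?gt_eqF// mulr1.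
by rewrite ger0_norm ?subr_ge0// lerBlDl natr1 ltW.
Qed.

End TestFunctions.

(** * Tuples with repetitions *)

Section Counting.
Variable R : realType.

(** The proportion of non-injective tuples among all [l]-tuples, as [n ^_ l] counts the injective
    ones. *)
Definition collision (n l : nat) : R := 1 - (n ^_ l)%:R / n%:R ^+ l.

(** If [n < l] the right side exceeds 1. Otherwise, passing from [l] to [l.+1] multiplies the
    injective proportion by [1 - l/n], which costs at most [l/n]. *)
Lemma collision_le (n l : nat) : (0 < n)%N -> collision n l <= (l * l)%:R / n%:R.
Proof.
move=> n0; have nR : 0 < n%:R :> R by rewrite ltr0n.
rewrite /collision lerBlDr -lerBlDl.
have [nl|ln] := ltnP n l.
  apply: (@le_trans _ _ 0); last by rewrite divr_ge0// exprn_ge0.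
  rewrite subr_le0 ler_pdivlMr// mul1r ler_nat.
  by apply: leq_trans (ltnW nl) _; rewrite leq_pmulr// (leq_ltn_trans _ nl).
elim: l ln => [|l IHl] ln; first by rewrite ffactn0 mul0n mul0r subr0 expr0 divr1.
have {}IHl := IHl (ltnW ln).
set x := (n ^_ l)%:R / n%:R ^+ l in IHl.
have -> : (n ^_ l.+1)%:R / n%:R ^+ l.+1 = x * (1 - l%:R / n%:R).
  rewrite ffactnSr exprSr natrM invfM mulrACA (natrB _ (ltnW ln)) mulrBl mulfV//.
  by rewrite gt_eqF.
have x1 : x <= 1.
  rewrite /x ler_pdivrMr ?exprn_gt0// mul1r -natrX ler_nat.
  elim: (l) => [|k IHk]; first by rewrite ffactn0.
  by rewrite ffactnSr expnSr leq_mul// leq_subr.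
have l0 : 0 <= l%:R / n%:R :> R by rewrite divr_ge0.
have : x * (l%:R / n%:R) <= l%:R / n%:R by rewrite ler_piMl.
have : (l * l)%:R / n%:R + l%:R / n%:R <= (l.+1 * l.+1)%:R / n%:R :> R.
  by rewrite -mulrDl -natrD ler_pM2r ?invr_gt0// ler_nat mulSn mulnS; lia.
by rewrite mulrBr mulr1; lra.
Qed.

Lemma collision_count (n l : nat) : (0 < n)%N ->
  \sum_(r : {ffun 'I_l -> 'I_n}) (~~ injectiveb r)%:R = n%:R ^+ l * collision n l.
Proof.
move=> n0; rewrite /collision mulrBr mulr1 mulrCA mulfV ?mulr1; last first.
  by rewrite expf_neq0// pnatr_eq0 -lt0n.
have -> : \sum_(r : {ffun 'I_l -> 'I_n}) (~~ injectiveb r)%:R =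
    #|[set r : {ffun 'I_l -> 'I_n} | ~~ injectiveb r]|%:R :> R.
  rewrite -sum1dep_card natr_sum [RHS]big_mkcond/=; apply: eq_bigr => r _.
  by case: (injectiveb r).
rewrite -natrX.
have := card_inj_ffuns 'I_l 'I_n; rewrite !card_ord => <-.
have <- : #|{ffun 'I_l -> 'I_n}| = (n ^ l)%N by rewrite card_ffun !card_ord.
rewrite -(cardsC [set f : {ffun 'I_l -> 'I_n} | injectiveb f]) natrD addrAC subrr add0r.
by congr (_%:R); apply: eq_card => f; rewrite !inE.
Qed.

End Counting.

(** * Moments of products of empirical integrals *)

Section Expectation.
Variables (R : realType) (n : nat) (P : {ffun 'S_n -> R}).
Hypothesis lawP : is_law P.

Let P_ge0 s : 0 <= P s := lawP.1 s.

Lemma hit_ge0 l (p q : 'I_l -> 'I_n) : 0 <= hit P p q.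
Proof. by rewrite /hit /prob sumr_ge0. Qed.

Lemma prob_exists l (B : 'I_l -> pred 'S_n) :
  prob P (fun s => [exists a, B a s]) <= \sum_(a < l) prob P (B a).
Proof.
rewrite /prob (exchange_big_dep (fun s => [exists a, B a s]))/=; last first.
  by move=> a s _ Bs; apply/existsP; exists a.
apply: ler_sum => s /existsP[a Bas].
by rewrite (bigD1 a)//= lerDl sumr_ge0.
Qed.

(** On the bad event the trivial bound 1 is used, which costs its probability. *)
Lemma expectation_le (T : 'S_n -> R) (bad : pred 'S_n) (hi : R) : 0 <= hi ->
  (forall s, T s <= 1) -> (forall s, ~~ bad s -> T s <= hi) ->
  \sum_s P s * T s <= hi + prob P bad.
Proof.
move=> hi0 T1 Thi; rewrite -[hi]mul1r -lawP.2 mulr_suml /prob [X in _ + X]big_mkcond -big_split/=.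
apply: ler_sum => s _; case: ifPn => [_|bs]; last by rewrite addr0 ler_wpM2l// Thi.
by apply: (@le_trans _ _ (P s * 1)); rewrite ?ler_wpM2l// mulr1 lerDr mulr_ge0.
Qed.

Lemma expectation_ge (T : 'S_n -> R) (bad : pred 'S_n) (lo : R) : 0 <= lo ->
  (forall s, 0 <= T s) -> (forall s, ~~ bad s -> lo <= T s) ->
  lo * (1 - prob P bad) <= \sum_s P s * T s.
Proof.
move=> lo0 T0 Tlo; rewrite -lawP.2 /prob [X in _ - X]big_mkcond -sumrB mulr_sumr/=.
apply: ler_sum => s _; case: ifPn => [_|bs]; last first.
  by rewrite subr0 mulrC ler_wpM2l// Tlo.
by rewrite subrr mulr0 mulr_ge0.
Qed.

Section Moments.
Variables (l : nat) (u v : 'I_l -> 'I_n -> R).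
Hypotheses (n_gt0 : (0 < n)%N).
Hypotheses (u01 : forall a i, 0 <= u a i <= 1) (v01 : forall a i, 0 <= v a i <= 1).

Definition average (w : 'I_n -> R) : R := n%:R^-1 * \sum_(i < n) w i.

(** The variable X_a at the permutation [s]; here [u] and [v] are already sampled on indices. *)
Definition stat (a : 'I_l) (s : 'S_n) : R := average (fun i => u a i * v a (s i)).

Let weight (r t : {ffun 'I_l -> 'I_n}) : R := \prod_(a < l) (u a (r a) * v a (t a)).

Let weight_ge0 r t : 0 <= weight r t.
Proof.
by apply: prodr_ge0 => a _; rewrite mulr_ge0//; [case/andP: (u01 a (r a))|case/andP: (v01 a (t a))].
Qed.

Let weight_le1 r t : weight r t <= 1.
Proof.
apply: prodr_ile1 => a _; have /andP[u0 u1] := u01 a (r a); have /andP[v0 v1] := v01 a (t a).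
by rewrite mulr_ge0// mulr_ile1.
Qed.

Let nR : 0 < n%:R :> R. Proof. by rewrite ltr0n. Qed.

Lemma average01 w : (forall i, 0 <= w i <= 1) -> 0 <= average w <= 1.
Proof.
move=> w01; rewrite /average mulr_ge0 ?invr_ge0 ?sumr_ge0//=; last first.
  by move=> i _; case/andP: (w01 i).
rewrite mulrC ler_pdivrMr// mul1r.
apply: (@le_trans _ _ (\sum_(i < n) 1)); last by rewrite sumr_const card_ord.
by apply: ler_sum => i _; case/andP: (w01 i).
Qed.

Lemma stat01 a s : 0 <= stat a s <= 1.
Proof.
apply: average01 => i.
have /andP[u0 u1] := u01 a i; have /andP[v0 v1] := v01 a (s i).
by rewrite mulr_ge0// mulr_ile1.
Qed.

Let total_weight : \sum_r \sum_t weight r t =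
  n%:R ^+ l * n%:R ^+ l * \prod_(a < l) (average (u a) * average (v a)).
Proof.
have -> : \sum_r \sum_t weight r t = (\prod_a \sum_i u a i) * (\prod_a \sum_i v a i).
  rewrite !bigA_distr_bigA mulr_suml; apply: eq_bigr => r _.
  by rewrite mulr_sumr; apply: eq_bigr => t _; rewrite /weight big_split.
rewrite /average !big_split/= !prodr_const !card_ord !exprVn.
have : n%:R ^+ l != 0 :> R by rewrite expf_neq0// gt_eqF.
by move=> h; field.
Qed.

(** The contribution of the source tuple [r] once the product of the sums X_a is expanded. *)
Let slice (r : {ffun 'I_l -> 'I_n}) : R := \sum_s P s * \prod_(a < l) (u a (r a) * v a (s (r a))).

Let expectation_slices :
  \sum_s P s * \prod_(a < l) stat a s =
  (n%:R ^+ l)^-1 * \sum_(r : {ffun 'I_l -> 'I_n}) slice r.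
Proof.
rewrite /slice exchange_big/= mulr_sumr; apply: eq_bigr => s _.
rewrite -mulr_sumr mulrCA; congr (_ * _).
by rewrite /stat /average big_split/= prodr_const card_ord exprVn bigA_distr_bigA.
Qed.

Let sliceE r : slice r = \sum_t weight r t * hit P r t.
Proof.
(* Permutations are grouped by the image [t] of the tuple [r]. *)
rewrite /slice (partition_big (fun s : 'S_n => [ffun a => s (r a)]) xpredT)//=.
apply: eq_bigr => t _; rewrite /hit /prob mulr_sumr.
apply: eq_big => [s|s /eqP st].
  apply/eqP/forallP => [<- a|h]; first by rewrite ffunE.
  by apply/ffunP => a; rewrite ffunE; apply/eqP.
rewrite mulrC; congr (_ * _).
by apply: eq_bigr => a _; rewrite -st ffunE.
Qed.

Let slice_le1 r : slice r <= 1.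
Proof.
rewrite -lawP.2; apply: ler_sum => s _; apply: ler_piMr => //.
apply: prodr_ile1 => a _.
have /andP[u0 u1] := u01 a (r a); have /andP[v0 v1] := v01 a (s (r a)).
by rewrite mulr_ge0// mulr_ile1.
Qed.

Let hit_noninj (r t : {ffun 'I_l -> 'I_n}) :
  injective r -> ~~ injectiveb t -> hit P r t = 0.
Proof.
move=> ri; apply: contraNeq => ht; apply/injectiveP => a b tab.
have [s /forallP hs|] := pickP (fun s : 'S_n => [forall a, s (r a) == t a]); last first.
  by move=> h0; move: ht; rewrite /hit /prob big_pred0 ?eqxx.
by apply/ri/(@perm_inj _ s); rewrite (eqP (hs a)) (eqP (hs b)).
Qed.

Let weight_neq0 r t : weight r t != 0 -> (forall a, u a (r a) != 0) /\ (forall a, v a (t a) != 0).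
Proof.
move/prodf_neq0 => h; split=> a; have := h a isT; rewrite mulf_eq0 negb_or; by case/andP.
Qed.

(** A non-injective [r] contributes a slice of at most 1, and these add up to [collision] after
    normalisation. For injective [r], a non-injective [t] is never hit and the other terms obey the
    bound by [H]. *)
Lemma moment_le (H : R) : 0 <= H ->
  (forall r t : 'I_l -> 'I_n, injective r -> injective t ->
    (forall a, u a (r a) != 0) -> (forall a, v a (t a) != 0) -> hit P r t <= H) ->
  \sum_s P s * \prod_(a < l) stat a s <=
    n%:R ^+ l * H * \prod_(a < l) (average (u a) * average (v a)) + collision R n l.
Proof.
move=> H0 hitH; rewrite expectation_slices ler_pdivrMl ?exprn_gt0// mulrDr.
rewrite -collision_count// !mulrA mulrAC -total_weight mulr_suml -big_split/=.
apply: ler_sum => r _.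
have [/injectiveP ri|rn] := boolP (injectiveb r); last first.
  apply: (le_trans (slice_le1 r)); rewrite lerDr mulr_ge0//.
  exact: sumr_ge0.
rewrite addr0 sliceE mulr_suml; apply: ler_sum => t _.
have [->|w0] := eqVneq (weight r t) 0; first by rewrite !mul0r.
have [/injectiveP ti|tn] := boolP (injectiveb t); last first.
  by rewrite hit_noninj// mulr0 mulr_ge0.
by have [ur vt] := weight_neq0 w0; rewrite ler_wpM2l// hitH.
Qed.

(** Pairs with [r] or [t] non-injective are given up. Each has weight at most 1, and [collision] is
    paid once for [r] and once for [t], whence the factor 2. *)
Lemma moment_ge (H : R) : 0 <= H ->
  (forall r t : 'I_l -> 'I_n, injective r -> injective t ->
    (forall a, u a (r a) != 0) -> (forall a, v a (t a) != 0) -> H <= hit P r t) ->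
  n%:R ^+ l * H * (\prod_(a < l) (average (u a) * average (v a)) - 2 * collision R n l)
    <= \sum_s P s * \prod_(a < l) stat a s.
Proof.
move=> H0 hitH; rewrite expectation_slices ler_pdivlMl ?exprn_gt0//.
set N := n%:R ^+ l; set A := \prod_(a < l) _.
have -> : N * (N * H * (A - 2 * collision R n l)) =
    (N * N * A - N * (N * collision R n l) - N * (N * collision R n l)) * H by ring.
rewrite -total_weight /N -collision_count//.
have NE : n%:R ^+ l = \sum_(t : {ffun 'I_l -> 'I_n}) 1 :> R.
  by rewrite sumr_const card_ffun !card_ord natrX.
have E1 : n%:R ^+ l * \sum_(r : {ffun 'I_l -> 'I_n}) (~~ injectiveb r)%:R =
    \sum_(r : {ffun 'I_l -> 'I_n}) \sum_(t : {ffun 'I_l -> 'I_n}) (~~ injectiveb r)%:R :> R.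
  rewrite mulr_sumr; apply: eq_bigr => r _; rewrite NE mulr_suml.
  by apply: eq_bigr => t _; rewrite mul1r.
have E2 : n%:R ^+ l * \sum_(r : {ffun 'I_l -> 'I_n}) (~~ injectiveb r)%:R =
    \sum_(r : {ffun 'I_l -> 'I_n}) \sum_(t : {ffun 'I_l -> 'I_n}) (~~ injectiveb t)%:R :> R.
  by rewrite E1 exchange_big.
(* With one collision term written over [r] and the other over [t], the inequality holds pair by
   pair: a non-injective pair makes the left side at most 0. *)
rewrite {1}E1 E2 -!sumrB mulr_suml; apply: ler_sum => r _.
rewrite sliceE -!sumrB mulr_suml; apply: ler_sum => t _.
have wh0 : 0 <= weight r t * hit P r t by rewrite mulr_ge0// hit_ge0.
have w1 := weight_le1 r t.
have [/injectiveP ri|rn] := boolP (injectiveb r); last first.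
  apply: le_trans wh0; rewrite mulr_le0_ge0//=.
  by have : 0 <= (~~ injectiveb t)%:R :> R by []; lra.
have [/injectiveP ti|tn] := boolP (injectiveb t); last first.
  by apply: le_trans wh0; rewrite mulr_le0_ge0//=; lra.
rewrite /= !subr0.
have [->|w0] := eqVneq (weight r t) 0; first by rewrite !mul0r.
by have [ur vt] := weight_neq0 w0; rewrite ler_wpM2l// hitH.
Qed.

End Moments.
End Expectation.

(** * Two-sided estimate of the normalised probability *)

Section Comparison.
Variable R : realType.

Lemma prod_bounds (l : nat) (t : R) (x y : 'I_l -> R) : 0 <= t <= 1 ->
  (forall a, 0 <= x a) ->
  (forall a, (1 - t) * x a <= y a <= (1 + t) * x a) ->
  (1 - t) ^+ l * \prod_a x a <= \prod_a y a <= (1 + t) ^+ l * \prod_a x a.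
Proof.
move=> /andP[t0 t1] x0 xy.
have lo0 a : 0 <= (1 - t) * x a by rewrite mulr_ge0// subr_ge0.
have E c : c ^+ l * \prod_a x a = \prod_a (c * x a).
  by rewrite big_split/= prodr_const card_ord.
rewrite !E; apply/andP; split; apply: ler_prod => a _.
  by rewrite lo0; case/andP: (xy a).
by case/andP: (xy a) => h1 ->; rewrite andbT (le_trans _ h1).
Qed.

(** The expectation of the product of the X_a is bounded on both sides by the moment lemmas and
    again by the good-event estimates; the results are compared and divided by [G * D]. Each
    exponent [2 * l] stands for two families of [l] relative errors [t]: averages of [u] and of [v]
    in one case, [stat] against [I] and [I] against [x U V] in the other. *)
Lemma hit_ratio_bounds (n l : nat) (P : {ffun 'S_n -> R}) (p q : 'I_l -> 'I_n)
    (u v : 'I_l -> 'I_n -> R) (U V I x : 'I_l -> R) (t e : R) :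
  is_law P -> (0 < n)%N -> 0 < t < 1 ->
  (forall a i, 0 <= u a i <= 1) -> (forall a i, 0 <= v a i <= 1) ->
  (forall a, 0 < U a) -> (forall a, 0 < V a) -> (forall a, 0 < x a) ->
  (forall a, `|average (u a) - U a| <= t * U a) ->
  (forall a, `|average (v a) - V a| <= t * V a) ->
  (forall a, (1 - t) * (x a * (U a * V a)) <= I a <= (1 + t) * (x a * (U a * V a))) ->
  (forall a, e <= t * I a) ->
  let D := \prod_a (U a * V a) in let G := \prod_a x a in
  let bad := fun s => [exists a, e < `|stat u v a s - I a|] in
  prob P bad <= t -> prob P bad <= t * (G * D) ->
  collision R n l <= t * D -> collision R n l <= t * (G * D) ->
  (forall r s : 'I_l -> 'I_n, injective r -> injective s ->
    (forall a, u a (r a) != 0) -> (forall a, v a (s a) != 0) ->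
    (1 - t) * hit P p q <= hit P r s <= (1 + t) * hit P p q) ->
  let Y := n%:R ^+ l * hit P p q / G in
  (1 - t) ^+ (2 * l) * (1 - t) - t <= Y * (1 + t) * (1 + t) ^+ (2 * l) /\
  Y * (1 - t) * ((1 - t) ^+ (2 * l) - 2 * t) <= (1 + t) ^+ (2 * l) + t.
Proof.
move=> lawP n0 /andP[t0 t1] u01 v01 U0 V0 x0 uU vV Ix eI D G bad bad1 bad2 col1 col2 hitb Y.
have t01 : 0 <= t <= 1 by rewrite !ltW.
have UV0 a : 0 < U a * V a by rewrite mulr_gt0.
have D0 : 0 < D by apply: prodr_gt0 => a _.
have G0 : 0 < G by apply: prodr_gt0 => a _.
have h0 := hit_ge0 lawP p q.
have tt0 : 0 < 1 - t by rewrite subr_gt0.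
have GD : G * D = \prod_a (x a * (U a * V a)) by rewrite big_split.
have Y0 : 0 <= Y by rewrite /Y divr_ge0 ?(ltW G0)// mulr_ge0// exprn_ge0.
have nh : n%:R ^+ l * hit P p q = Y * G by rewrite /Y divfK// gt_eqF.
have avgE : (1 - t) ^+ (2 * l) * D <= \prod_a (average (u a) * average (v a))
    <= (1 + t) ^+ (2 * l) * D.
  have big2 (f g : 'I_l -> R) : \prod_a (f a * g a) = (\prod_a f a) * \prod_a g a.
    by rewrite big_split.
  rewrite /D (big2 U V) (big2 (fun a => average (u a))) mul2n -addnn !exprD.
  have /andP[u1 u2] : (1 - t) ^+ l * \prod_a U a <= \prod_a average (u a)
      <= (1 + t) ^+ l * \prod_a U a.
    apply: prod_bounds => // a; first exact: ltW.
    by have := uU a; rewrite ler_distl; lra.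
  have /andP[v1 v2] : (1 - t) ^+ l * \prod_a V a <= \prod_a average (v a)
      <= (1 + t) ^+ l * \prod_a V a.
    apply: prod_bounds => // a; first exact: ltW.
    by have := vV a; rewrite ler_distl; lra.
  have U'0 : 0 <= (1 - t) ^+ l * \prod_a U a.
    by rewrite mulr_ge0 ?exprn_ge0 ?ltW// prodr_gt0.
  have V'0 : 0 <= (1 - t) ^+ l * \prod_a V a.
    by rewrite mulr_ge0 ?exprn_ge0 ?ltW// prodr_gt0.
  rewrite ![_ ^+ l * _ ^+ l * _]mulrACA; apply/andP; split; first exact: ler_pM.
  by apply: ler_pM => //; [exact: (le_trans U'0)|exact: (le_trans V'0)].
have statE s : ~~ bad s -> (1 - t) ^+ (2 * l) * (G * D) <= \prod_a stat u v a s
    <= (1 + t) ^+ (2 * l) * (G * D).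
  rewrite negb_exists => /forallP good.
  have I0 a : 0 < I a.
    by case/andP: (Ix a) => h _; apply: lt_le_trans h; rewrite !mulr_gt0.
  have /andP[s1 s2] : (1 - t) ^+ l * \prod_a I a <= \prod_a stat u v a s
      <= (1 + t) ^+ l * \prod_a I a.
    apply: prod_bounds => // a; first exact: ltW.
    have := good a; rewrite -leNgt => /le_trans/(_ (eI a)).
    by rewrite ler_distl; lra.
  have /andP[i1 i2] : (1 - t) ^+ l * (G * D) <= \prod_a I a <= (1 + t) ^+ l * (G * D).
    by rewrite GD; apply: prod_bounds => // a; rewrite ltW// mulr_gt0.
  rewrite mul2n -addnn !exprD -!mulrA; apply/andP; split.
    by apply: le_trans s1; rewrite ler_wpM2l// exprn_ge0// ltW.
  by apply: (le_trans s2); rewrite ler_wpM2l// exprn_ge0// addr_ge0// ltW.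
have GD0 : 0 < G * D by rewrite mulr_gt0.
have a0 : 0 <= (1 - t) ^+ (2 * l) by rewrite exprn_ge0// ltW.
have b0 : 0 <= (1 + t) ^+ (2 * l) by rewrite exprn_ge0// addr_ge0// ltW.
have stat01' a s := stat01 n0 u01 v01 a s.
have ET_ge := @expectation_ge _ _ _ lawP (fun s => \prod_a stat u v a s) bad
  ((1 - t) ^+ (2 * l) * (G * D)) _ _ (fun s h => proj1 (andP (statE s h))).
have ET_le := @expectation_le _ _ _ lawP (fun s => \prod_a stat u v a s) bad
  ((1 + t) ^+ (2 * l) * (G * D)) _ _ (fun s h => proj2 (andP (statE s h))).
have {ET_ge}ET_ge : (1 - t) ^+ (2 * l) * (G * D) * (1 - prob P bad) <=
    \sum_s P s * \prod_a stat u v a s.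
  apply: ET_ge; first by rewrite mulr_ge0// ltW.
  by move=> s; apply: prodr_ge0 => a _; case/andP: (stat01' a s).
have {ET_le}ET_le : \sum_s P s * \prod_a stat u v a s <=
    (1 + t) ^+ (2 * l) * (G * D) + prob P bad.
  apply: ET_le; first by rewrite mulr_ge0// ltW.
  by move=> s; apply: prodr_ile1.
have H_le : \sum_s P s * \prod_a stat u v a s <= n%:R ^+ l * ((1 + t) * hit P p q) *
    \prod_a (average (u a) * average (v a)) + collision R n l.
  apply: moment_le => //; first by rewrite mulr_ge0// addr_ge0// ltW.
  by move=> r s ri si ru sv; case/andP: (hitb r s ri si ru sv).
have H_ge : n%:R ^+ l * ((1 - t) * hit P p q) *
    (\prod_a (average (u a) * average (v a)) - 2 * collision R n l) <=
    \sum_s P s * \prod_a stat u v a s.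
  apply: moment_ge => //; first by rewrite mulr_ge0// ltW.
  by move=> r s ri si ru sv; case/andP: (hitb r s ri si ru sv).
have {avgE}[av1 av2] := andP avgE.
(* The first inequality joins [ET_ge] to [H_le], the second [H_ge] to [ET_le]. *)
split.
  rewrite -(ler_pM2r GD0).
  have h1 : (1 - t) ^+ (2 * l) * (G * D) * (1 - t) <=
      (1 - t) ^+ (2 * l) * (G * D) * (1 - prob P bad).
    by rewrite ler_wpM2l ?lerB// mulr_ge0// ltW.
  have h2 : n%:R ^+ l * ((1 + t) * hit P p q) * \prod_a (average (u a) * average (v a)) <=
      n%:R ^+ l * ((1 + t) * hit P p q) * ((1 + t) ^+ (2 * l) * D).
    by rewrite ler_wpM2l// mulr_ge0 ?exprn_ge0// mulr_ge0// addr_ge0// ltW.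
  have h3 : n%:R ^+ l * ((1 + t) * hit P p q) * ((1 + t) ^+ (2 * l) * D) =
      Y * (1 + t) * (1 + t) ^+ (2 * l) * (G * D).
    by rewrite (mulrCA _ (1 + t)) nh; ring.
  rewrite -h3 mulrBl; lra.
rewrite -(ler_pM2r GD0).
have h2 : n%:R ^+ l * ((1 - t) * hit P p q) * ((1 - t) ^+ (2 * l) * D - 2 * (t * D)) <=
    n%:R ^+ l * ((1 - t) * hit P p q) *
    (\prod_a (average (u a) * average (v a)) - 2 * collision R n l).
  rewrite ler_wpM2l ?lerB//; last by rewrite ler_wpM2l.
  by rewrite mulr_ge0 ?exprn_ge0// mulr_ge0// ltW.
have h3 : n%:R ^+ l * ((1 - t) * hit P p q) * ((1 - t) ^+ (2 * l) * D - 2 * (t * D)) =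
    Y * (1 - t) * ((1 - t) ^+ (2 * l) - 2 * t) * (G * D).
  by rewrite (mulrCA _ (1 - t)) nh; ring.
rewrite -h3 mulrDl; lra.
Qed.

(** With [w = 4 l t], Bernoulli's inequality gives [a >= 1 - w/2], and [a * b <= 1] then gives
    [b <= 1 + w]. All factors are thus within a multiple of [w] of 1, and the hypotheses on [32 l t]
    say that [8 w] is at most [eps] and 1. *)
Lemma ratio_near1 (l : nat) (t eps Y : R) : (0 < l)%N -> 0 < t -> 0 <= Y ->
  32 * l%:R * t <= eps -> 32 * l%:R * t <= 1 ->
  (1 - t) ^+ (2 * l) * (1 - t) - t <= Y * (1 + t) * (1 + t) ^+ (2 * l) ->
  Y * (1 - t) * ((1 - t) ^+ (2 * l) - 2 * t) <= (1 + t) ^+ (2 * l) + t ->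
  `|Y - 1| <= eps.
Proof.
move=> l0 t0 Y0 teps t1; set a := _ ^+ _; set b := (1 + t) ^+ _; move=> Ylo Yhi.
pose w := 4 * l%:R * t.
have l1 : 1 <= l%:R :> R by rewrite ler1n.
have w8 : 8 * w <= eps by rewrite /w; lra.
have w1 : 8 * w <= 1 by rewrite /w; lra.
have tl : t <= l%:R * t by rewrite ler_peMl// ltW.
have tw : 4 * t <= w by rewrite /w; lra.
have w0 : 0 < w by lra.
have bern (k : nat) : 1 - k%:R * t <= (1 - t) ^+ k.
  elim: k => [|k IHk]; first by rewrite mul0r subr0.
  rewrite exprS; apply: (@le_trans _ _ ((1 - t) * (1 - k%:R * t))); last first.
    by rewrite ler_wpM2l//; lra.
  have : 0 <= k%:R * t * t by rewrite !mulr_ge0// ltW.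
  by rewrite -natr1; lra.
have a1 : 1 - w <= a by have := bern (2 * l)%N; rewrite natrM -/a /w; lra.
have a2 : 1 - w / 2 <= a by have := bern (2 * l)%N; rewrite natrM -/a /w; lra.
have a0 : a <= 1 by rewrite /a exprn_ile1//; lra.
have ab : a * b <= 1.
  rewrite /a /b -exprMn exprn_ile1//; first by rewrite mulr_ge0//; lra.
  by have := mulr_ge0 (ltW t0) (ltW t0); lra.
have b0 : 0 <= b by rewrite /b exprn_ge0//; lra.
have b1 : b <= 1 + w by nra.
have lo : 1 - 3 / 2 * w <= Y * (1 + w) * (1 + w).
  apply: (@le_trans _ _ (a * (1 - t) - t)); first by nra.
  apply: (le_trans Ylo); apply: ler_pM => //; first by rewrite mulr_ge0//; lra.
  by rewrite ler_wpM2l//; lra.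
have hi : Y * ((1 - w) * (1 - 3 / 2 * w)) <= 1 + 5 / 4 * w.
  apply: (@le_trans _ _ (b + t)); last by lra.
  apply: le_trans Yhi; rewrite -[leRHS]mulrA ler_wpM2l//; apply: ler_pM; lra.
rewrite ler_norml; apply/andP; split; nra.
Qed.

End Comparison.

(** * Quantities that become small as [n] grows *)

Section Convergence.
Local Open Scope classical_set_scope.
Variables (R : realType) (P : forall n : nat, {ffun 'S_n -> R}) (rho : R * R -> R).
Hypotheses (lawP : forall n, (0 < n)%N -> is_law (P n)) (Crho : classC rho)
  (convP : conv_in_prob P rho).

Lemma gpt01 n (i : 'I_n) : 0 <= gpt R i <= 1.
Proof.
have n0 : (0 < n)%N by rewrite (leq_ltn_trans _ (ltn_ord i)).
by rewrite /gpt divr_ge0//= ler_pdivrMr ?ltr0n// mul1r ler_nat.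
Qed.

(* The event below is deterministic, so convergence in probability to a law
   with uniform first marginal gives convergence of Riemann sums. *)
Lemma average_cvg (u : R -> R) : continuous u -> forall e : R, 0 < e ->
  \forall n \near \oo, `|average (fun i : 'I_n => u (gpt R i)) - int01 u| <= e.
Proof.
move=> cu e e0.
have [N HN] := convP (continuous_fst_sq cu) e0 (@divr_gt0 _ 1 2 ltr01 (@ltr0Sn _ 1)).
near=> n.
have n0 : (0 < n)%N by near: n; exact: nbhs_infty_gt.
have /HN : (N <= n)%N by near: n; exact: nbhs_infty_ge.
rewrite (int_sq_marginal Crho cu) /= /prob.
(* If the bound failed, the event would be all of ['S_n], of probability 1, above the level [1/2]
   chosen for [eta]. *)
apply: contraTT; rewrite -!ltNge => lt_e.
rewrite [ltRHS](eq_bigl xpredT); last by move=> s; exact: lt_e.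
by rewrite (lawP n0).2; lra.
Unshelve. all: by end_near.
Qed.

Lemma stat_cvg (u v : R -> R) : continuous u -> continuous v ->
  forall e : R, 0 < e -> forall eta : R, 0 < eta ->
  \forall n \near \oo, prob (P n) (fun s => e < `|average (fun i => u (gpt R i) * v (gpt R (s i)))
     - int_sq (fun z => u z.1 * v z.2 * rho z)|) <= eta.
Proof.
move=> cu cv e e0 eta eta0.
have [N HN] := convP (continuous_tensor_sq cu cv) e0 eta0.
by exists N => // n /= /HN.
Qed.

Lemma collision_cvg (l : nat) (e : R) : 0 < e -> \forall n \near \oo, collision R n l <= e.
Proof.
move=> e0; near=> n.
have n0 : (0 < n)%N by near: n; exact: nbhs_infty_gt.
apply: le_trans (collision_le R l n0) _.
rewrite ler_pdivrMr ?ltr0n// mulrC -ler_pdivrMr//.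
near: n; exact: nbhs_infty_ger.
Unshelve. all: by end_near.
Qed.

End Convergence.

(** * Choice of scales and conclusion *)

Theorem theorem1p1 (R : realType) (l : nat) (hl : (0 < l)%N)
  (P : forall n : nat, {ffun 'S_n -> R})
  (hP : forall n : nat, (0 < n)%N -> is_law (P n))
  (heq : equicont l P)
  (rho : R * R -> R) (hrho : classC rho)
  (hconv : conv_in_prob P rho) :
  forall eps : R, 0 < eps -> exists N : nat, forall n : nat, (N <= n)%N ->
  forall p q : 'I_l -> 'I_n, distinct_tuple p -> distinct_tuple q ->
    `| (n%:R ^+ l * hit (P n) p q)
         / (\prod_(a < l) rho (gpt R (p a), gpt R (q a))) - 1 | <= eps.
Proof.
move=> eps eps0; have [crho [rho0 _]] := hrho.
have l0 : 0 < l%:R :> R by rewrite ltr0n.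
have l1 : 1 <= l%:R :> R by rewrite ler1n.
have in_sq (x y : R) : 0 <= x <= 1 -> 0 <= y <= 1 -> (`[0, 1] `*` `[0, 1])%classic (x, y).
  by move=> x01 y01; split; rewrite /= in_itv.
have [t t0 [teps t1]] : exists2 t : R, 0 < t & 32 * l%:R * t <= eps /\ 32 * l%:R * t <= 1.
  exists (Num.min eps 1 / (32 * l%:R)).
    by rewrite divr_gt0 ?mulr_gt0// lt_min eps0 ltr01.
  by rewrite mulrC divfK ?gt_eqF ?mulr_gt0// !ge_min !lexx orbT.
have tl1 : t < 1 by have : t <= l%:R * t; [rewrite ler_peMl// ltW | lra].
have [c c0 [c1 rhoc]] : exists2 c : R, 0 < c & c <= 1 /\
    forall z, (`[0, 1] `*` `[0, 1])%classic z -> c <= rho z.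
  have [|c c0 cmin] := square_min crho.
    by case=> x y [/=]; rewrite !in_itv/=; exact: rho0.
  exists (Num.min c 1); first by rewrite lt_min c0 ltr01.
  by split => [|z Kz]; rewrite ge_min ?lexx ?orbT// cmin.
(* An oscillation below [t * c] is a relative error below [t], since [rho >= c]. *)
have [d1 d1_gt0 rho_d1] := unif_continuous_square crho (mulr_gt0 t0 c0).
have [d2 d2_gt0 [N1 hit_d2]] := heq _ t0.
have [m m0 [md1 md2]] : exists2 m : nat, (0 < m)%N & 2 / m%:R < d1 /\ 2 / m%:R < d2 :> R.
  pose d := Num.min d1 d2; have d0 : 0 < d by rewrite lt_min d1_gt0.
  exists (Num.truncn (2 / d)).+1 => //.
  have /andP[_ h] := truncn_itv (ltW (divr_gt0 (ltr0Sn R 1) d0)).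
  have : 2 / (Num.truncn (2 / d)).+1%:R < d.
    by rewrite ltr_pdivrMr ?ltr0n// mulrC -ltr_pdivrMr.
  by rewrite lt_min => /andP.
have mR : 0 < m%:R :> R by rewrite ltr0n.
pose d : R := (4 * m%:R)^-1.
have d0 : 0 < d by rewrite invr_gt0 mulr_gt0.
have dd0 : 0 < d * d by rewrite mulr_gt0.
have dd1 : d * d <= 1.
  have d1' : d <= 1.
    have : 1 <= m%:R :> R by rewrite ler1n.
    by move=> h; rewrite invf_le1 ?mulr_gt0//; lra.
  by rewrite mulr_ile1// ltW.
(* [K] lies below [t], [t * D] and [t * (G * D)] for every choice of tuples, and [e] below
   [t * I a]; neither depends on [n], [p] or [q]. *)
pose K : R := t * (c ^+ l * (d * d) ^+ l).
have K0 : 0 < K by rewrite !mulr_gt0 ?exprn_gt0.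
pose e : R := t * ((1 - t) * (c * (d * d))).
have e0 : 0 < e by rewrite !mulr_gt0// subr_gt0.
pose ten (k : 'I_m.+1) : R -> R := tent m k.
have cten (k : 'I_m.+1) : continuous (ten k) by exact: continuous_tent.
have Uten k : d <= int01 (ten k) by apply: int01_tent => //; rewrite -ltnS.
have Uten0 k : 0 < int01 (ten k) by exact: lt_le_trans (Uten k).
have tU0 k : 0 < t * int01 (ten k) by rewrite mulr_gt0.
suff [N _ HN] : (\forall n \near \oo, forall p q : 'I_l -> 'I_n,
    distinct_tuple p -> distinct_tuple q ->
    `| (n%:R ^+ l * hit (P n) p q)
         / (\prod_(a < l) rho (gpt R (p a), gpt R (q a))) - 1 | <= eps)%classic.
  by exists N.
near=> n.
have n0 : (0 < n)%N by near: n; exact: nbhs_infty_gt.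
have nN1 : (N1 <= n)%N by near: n; exact: nbhs_infty_ge.
(* There are finitely many tents, so one threshold on [n] serves all of them, before [p] and [q] are
   introduced. *)
have avgn (k : 'I_m.+1) :
    `|average (fun i : 'I_n => ten k (gpt R i)) - int01 (ten k)| <= t * int01 (ten k).
  move: (k); near: n; apply: filter_forall => k'.
  exact: (average_cvg hP hrho hconv (cten k') (tU0 k')).
have statn (kj : 'I_m.+1 * 'I_m.+1) : prob (P n) (fun s =>
    e < `|average (fun i => ten kj.1 (gpt R i) * ten kj.2 (gpt R (s i)))
       - int_sq (fun z => ten kj.1 z.1 * ten kj.2 z.2 * rho z)|) <= K / l%:R.
  (* The level [K / l] leaves room for a union bound over the [l] coordinates. *)
  move: (kj); near: n; apply: filter_forall => kj'.
  exact: (stat_cvg hconv (cten _) (cten _) e0 (divr_gt0 K0 l0)).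
have coln : collision R n l <= K by near: n; exact: collision_cvg.
move=> p q pinj qinj; have nR : 0 < n%:R :> R by rewrite ltr0n.
have [k kp] := choice (fun a => grid_near m0 (gpt01 R (p a))).
have [j jq] := choice (fun a => grid_near m0 (gpt01 R (q a))).
(* The distance [2/m] is the rounding error to the grid plus the support radius of the tent. *)
have near_supp (h : 'I_m.+1) (y x : R) : `|y - h%:R / m%:R| <= m%:R^-1 ->
    ten h x != 0 -> `|x - y| < 2 / m%:R.
  move=> yh /(tent_supp m0) xh.
  have -> : 2 / m%:R = m%:R^-1 + m%:R^-1 :> R by rewrite mulrDl mul1r.
  rewrite -(subrKA (h%:R / m%:R)) (le_lt_trans (ler_normD _ _))//.
  by rewrite ltr_leD// distrC.
(* The shift by one in [gpt] cancels in the difference. *)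
have gpt_close (i i' : 'I_n) : `|gpt R i - gpt R i'| <= d2 ->
    `|i%:R - i'%:R| <= n%:R * d2 :> R.
  rewrite /gpt -mulrBl -!natr1 [in X in X -> _]opprD addrACA subrr addr0.
  by rewrite normrM [X in _ * X]gtr0_norm ?invr_gt0// ler_pdivrMr// mulrC.
pose x a := rho (gpt R (p a), gpt R (q a)).
have xc a : c <= x a by apply: rhoc; apply: in_sq; exact: gpt01.
have x0 a : 0 < x a by exact: lt_le_trans (xc a).
have ten01 h i : 0 <= ten h (gpt R i) <= 1 by rewrite tent_ge0 tent_le1.
have Dge : (d * d) ^+ l <= \prod_a (int01 (ten (k a)) * int01 (ten (j a))).
  rewrite -[X in _ ^+ X]card_ord -prodr_const; apply: ler_prod => a _.
  by rewrite ltW//= ler_pM// ltW.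
have Gge : c ^+ l <= \prod_a x a.
  rewrite -[X in _ ^+ X]card_ord -prodr_const; apply: ler_prod => a _.
  by rewrite ltW//= xc.
have K_GD : K <= t * (\prod_a x a * \prod_a (int01 (ten (k a)) * int01 (ten (j a)))).
  by rewrite ler_pM2l// ler_pM// exprn_ge0// ltW.
have K_D : K <= t * \prod_a (int01 (ten (k a)) * int01 (ten (j a))).
  rewrite ler_pM2l//; apply: le_trans Dge.
  by rewrite ler_piMl ?exprn_ge0 ?exprn_ile1// ltW.
have K_t : K <= t.
  by rewrite ger_pMr// mulr_ile1 ?exprn_ge0 ?exprn_ile1// ltW.
have Ib a : (1 - t) * (x a * (int01 (ten (k a)) * int01 (ten (j a))))
    <= int_sq (fun z => ten (k a) z.1 * ten (j a) z.2 * rho z)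
    <= (1 + t) * (x a * (int01 (ten (k a)) * int01 (ten (j a)))).
  rewrite !(mulrA _ (x a)); apply: int_sq_tensor_bounds => //.
  - by move=> ?; exact: tent_ge0.
  - by move=> ?; exact: tent_ge0.
  case=> y y' Kyy /= ky jy.
  have := rho_d1 y y' (gpt R (p a)) (gpt R (q a)) Kyy (in_sq _ _ (gpt01 R (p a)) (gpt01 R (q a)))
    (lt_trans (near_supp _ _ _ (kp a) ky) md1) (lt_trans (near_supp _ _ _ (jq a) jy) md1).
  have : t * c <= t * x a by rewrite ler_pM2l.
  by rewrite -/(x a) ltr_distl; lra.
have bad_K : prob (P n) (fun s => [exists a, e <
    `|stat (fun a i => ten (k a) (gpt R i)) (fun a i => ten (j a) (gpt R i)) a s
      - int_sq (fun z => ten (k a) z.1 * ten (j a) z.2 * rho z)|]) <= K.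
  apply: (le_trans (prob_exists (hP n n0) _)).
  apply: (@le_trans _ _ (\sum_(a < l) (K / l%:R))).
    by apply: ler_sum => a _; exact: (statn (k a, j a)).
  by rewrite sumr_const card_ord -[leLHS]mulr_natr divfK// gt_eqF.
have [||||||||||lo hi] := @hit_ratio_bounds R n l (P n) p q
    (fun a i => ten (k a) (gpt R i)) (fun a i => ten (j a) (gpt R i))
    (fun a => int01 (ten (k a))) (fun a => int01 (ten (j a)))
    (fun a => int_sq (fun z => ten (k a) z.1 * ten (j a) z.2 * rho z)) x t e (hP n n0) n0 _
    _ _ _ _ _ _ _ Ib _ (le_trans bad_K K_t) (le_trans bad_K K_GD) (le_trans coln K_D)
    (le_trans coln K_GD) _ => //.
- by rewrite t0.
- move=> a; rewrite ler_pM2l//; case/andP: (Ib a) => h _; apply: le_trans h.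
  rewrite ler_pM2l ?subr_gt0//; apply: ler_pM => //; try exact: ltW.
  by apply: ler_pM => //; exact: ltW.
- move=> r s rinj sinj ru sv.
  have := hit_d2 n nN1 r s p q rinj sinj pinj qinj.
  have hr a : `|(r a)%:R - (p a)%:R| <= n%:R * d2 :> R.
    by apply/gpt_close/ltW/(lt_trans _ md2)/(near_supp _ _ _ (kp a) (ru a)).
  have hs a : `|(s a)%:R - (q a)%:R| <= n%:R * d2 :> R.
    by apply/gpt_close/ltW/(lt_trans _ md2)/(near_supp _ _ _ (jq a) (sv a)).
  move=> /(_ hr hs); have := hit_ge0 (hP n n0) p q.
  (* If the reference probability were 0, division by zero would make the quotient 0, and
     equicontinuity would give [1 <= t], against [tl1]. *)
  rewrite le_eqVlt => /predU1P[<-|h0].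
    by rewrite invr0 mulr0 sub0r normrN normr1 leNgt tl1.
  by rewrite ler_distl -(ler_pM2r h0) -[X in _ && X](ler_pM2r h0) divfK ?gt_eqF//.
apply: (ratio_near1 hl t0 _ teps t1 lo hi).
rewrite divr_ge0 ?mulr_ge0 ?exprn_ge0 ?(hit_ge0 (hP n n0))//.
by apply: prodr_ge0 => a _; exact: ltW.
Unshelve. all: by end_near.
Qed.
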